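(* Let $K$ be the class of cotorsionfree abelian groups, let $\lambda=(2^{\aleph_0})^+$, let $\psi$ be a sentence of the infinitary language $L_{\lambda,\omega}$ (in the vocabulary $\{+,-,0\}$ of groups) such that $K=\mathrm{Mod}(\psi)$, and let $\mathbb{A}$ be a fragment of $L_{\lambda,\omega}$ containing $\psi$. For $G,H\in K$ define $G<_K H$ if and only if $G$ is an $L_{\mathbb{A}}$-elementary substructure of $H$. Then $(K,<_K)$ is an abstract elementary class, with Löwenheim–Skolem number $\mathrm{LS}(K)=|\mathbb{A}|$.
   Context: A group $G$ is cotorsion if $\mathrm{Ext}(J,G)=0$ for every torsionfree abelian group $J$; it is cotorsionfree if it has no nonzero cotorsion subgroup (equivalently, no subgroup isomorphic to $\mathbb{Q}$, $\mathbb{Z}/p\mathbb{Z}$ or the $p$-adic integers $J_p$, $p$ prime). It is a known theorem (Kolman–Shelah) that a sentence $\psi$ of $L_{\lambda,\omega}$, $\lambda=(2^{\aleph_0})^+$, with $K=\mathrm{Mod}(\psi)$ exists. $L_{\lambda,\omega}$ allows conjunctions and disjunctions of fewer than $\lambda$ formulas and finite quantifier strings. A fragment $\mathbb{A}$ is a set of formulas of $L_{\lambda,\omega}$ containing the atomic formulas and closed under subformulas, substitution of terms for variables, and the finitary first-order operations. $G$ is an $L_{\mathbb{A}}$-elementary substructure of $H$ if $G\subseteq H$ and for every $\varphi(\bar x)\in\mathbb{A}$ and $\bar a$ from $G$, $G\models\varphi(\bar a)$ iff $H\models\varphi(\bar a)$. Let $C$ be a class of structures of one similarity type and $<_C$ a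 binary relation on $C$; write $M\subseteq N$ for ''$M$ is a substructure of $N$''. $(C,<_C)$ is an abstract elementary class if: (A0) $C$ and $<_C$ are closed under isomorphism: if $f$ is an isomorphism of $M\in C$ onto $N$ then $N\in C$; and if $f_i$ is an isomorphism from $M_i$ onto $N_i$ ($i=0,1$), $M_0<_C M_1$ and $f_0\subseteq f_1$, then $N_0<_C N_1$. (A1) $<_C$ is a (reflexive) partial order on $C$. (A2) If $M<_C N$ then $M\subseteq N$. (A3) If $\langle A_\alpha:\alpha<\delta\rangle$ ($\delta$ a nonzero ordinal) is a continuous $<_C$-increasing chain (all $A_\alpha\in C$, $A_\alpha<_C A_{\alpha+1}$, and $A_\xi=\bigcup_{\zeta<\xi}A_\zeta$ for limit $\xi$), then (1) $\bigcup_{\alpha<\delta}A_\alpha\in C$; (2) for each $\beta<\delta$, $A_\beta<_C\bigcup_{\alpha<\delta}A_\alpha$; (3) if $A_\beta<_C M\in C$ for each $\beta<\delta$, then $\bigcup_{\alpha<\delta}A_\alpha<_C M$. (A4) If $A,B,D\in C$, $A<_C D$, $B<_C D$ and $A\subseteq B$, then $A<_C B$. (A5) There is a cardinal $\mathrm{LS}(C)$ (a Löwenheim–Skolem number) such that if $A\subseteq B\in C$, there exists $A'\in C$ with $A\subseteq A'$, $A'<_C B$ and $|A'|\le|A|+\mathrm{LS}(C)$. The assertion about $\mathrm{LS}(K)$ means that (A5) holds with $\mathrm{LS}(K)=|\mathbb{A}|$. *)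

(* Defs.v *)
From HB Require Import structures.
From mathcomp Require Import all_boot all_algebra.
From mathcomp Require Import boolp classical_sets functions cardinality wochoice.

Set Implicit Arguments.
Unset Strict Implicit.
Unset Printing Implicit Defensive.

Import GRing.Theory.

Local Open Scope classical_set_scope.
Local Open Scope card_scope.
Local Open Scope ring_scope.

Record extension (J G : zmodType) := Extension {
  ext_mid : zmodType;
  ext_in : {additive G -> ext_mid};
  ext_out : {additive ext_mid -> J};
  ext_in_inj : injective ext_in;
  ext_out_surj : forall j, exists e, ext_out e = j;
  ext_exact : forall e, ext_out e = 0 <-> exists g, ext_in g = e
}.

Definition ext_equiv (J G : zmodType) (E F : extension J G) : Prop :=
  exists f : {additive ext_mid E -> ext_mid F},
    [/\ bijective f,
        forall g, f (ext_in E g) = ext_in F g &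
        forall e, ext_out F (f e) = ext_out E e].

Section SplitExtension.
Variables J G : zmodType.

Definition split_in (g : G) : (G * J)%type := (g, 0).
Definition split_out (e : (G * J)%type) : J := e.2.

Lemma split_in_is_additive : zmod_morphism split_in.
Proof. by move=> x y; rewrite /split_in -[RHS]/(_, _) subr0. Qed.

Lemma split_out_is_additive : zmod_morphism split_out.
Proof. by []. Qed.

HB.instance Definition _ :=
  GRing.isZmodMorphism.Build G (G * J)%type split_in split_in_is_additive.
HB.instance Definition _ :=
  GRing.isZmodMorphism.Build (G * J)%type J split_out split_out_is_additive.

Lemma split_in_inj : injective split_in.
Proof. by move=> x y []. Qed.

Lemma split_out_surj j : exists e, split_out e = j.
Proof. by exists (0, j). Qed.

Lemma split_exact e : split_out e = 0 <-> exists g, split_in g = e.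
Proof.
by case: e => g j; split=> [/= | [h [_ <-]]] //; rewrite /split_out /= => ->; exists g.
Qed.

Definition split_extension : extension J G :=
  Extension split_in_inj split_out_surj split_exact.

End SplitExtension.

(** Ext(J, G) is the group of extensions of J by G up to equivalence, whose
    zero is the class of the direct sum. *)
Definition Ext_eq0 (J G : zmodType) : Prop :=
  forall E : extension J G, ext_equiv E (split_extension J G).

Definition torsionfree (J : zmodType) : Prop :=
  forall (x : J) (n : nat), (0 < n)%N -> x *+ n = 0 -> x = 0.

Definition cotorsion (G : zmodType) : Prop :=
  forall J : zmodType, torsionfree J -> Ext_eq0 J G.

Definition cotorsionfree (G : zmodType) : Prop :=
  forall (S : {pred G}) (H : subZmodType S),
    cotorsion H -> forall x : H, x = 0.

Record group_ops (T : Type) := GroupOps {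
  op_add : T -> T -> T;
  op_opp : T -> T;
  op_zero : T
}.

(** As in set theory, universes of structures are sets: here, subsets of an
    ambient type [U], so that inclusions and unions of structures make sense.
    A class of structures is a family of predicates indexed by [U]. *)
Record structure (U : Type) := Structure {
  dom : set U;
  ops : group_ops dom
}.

Definition substructure (U : Type) (M N : structure U) : Prop :=
  [/\ dom M `<=` dom N,
      forall (x y : dom M) (x' y' : dom N), val x = val x' -> val y = val y' ->
        val (op_add (ops M) x y) = val (op_add (ops N) x' y'),
      forall (x : dom M) (x' : dom N), val x = val x' ->
        val (op_opp (ops M) x) = val (op_opp (ops N) x') &
      val (op_zero (ops M)) = val (op_zero (ops N))].

Definition isomorphism (U V : Type) (M : structure U) (N : structure V)
    (f : dom M -> dom N) : Prop :=
  [/\ bijective f,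
      forall x y, f (op_add (ops M) x y) = op_add (ops N) (f x) (f y),
      forall x, f (op_opp (ops M) x) = op_opp (ops N) (f x) &
      f (op_zero (ops M)) = op_zero (ops N)].

Record abelian_group_ops (T : Type) (O : group_ops T) : Prop := AbelianGroupOps {
  op_addA : associative (op_add O);
  op_addC : commutative (op_add O);
  op_add0 : left_id (op_zero O) (op_add O);
  op_addN : left_inverse (op_zero O) (op_opp O) (op_add O)
}.

Definition zmod_of (T : Type) (O : group_ops T) (HO : abelian_group_ops O) :
    zmodType :=
  HB.pack {classic T}
    (@GRing.isZmodule.Build {classic T} (op_zero O) (op_opp O) (op_add O)
       (op_addA HO) (op_addC HO) (op_add0 HO) (op_addN HO)).

Definition cotorsionfree_group (U : Type) (M : structure U) : Prop :=
  exists HM : abelian_group_ops (ops M), cotorsionfree (zmod_of HM).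

Inductive term (n : nat) : Type :=
| Var of 'I_n
| Zero
| Opp of term n
| Add of term n & term n.
Arguments Zero {n}.

(** Formulas of L_{lambda, omega} for lambda = (2 ^ aleph_0)^+.
    [form n] is the type of formulas whose free variables are among
    x_0, ..., x_(n-1): as usual for this language, a formula has only finitely
    many free variables.  Quantifiers bind the variable of index 0 (de Bruijn).
    "Fewer than lambda" means "at most 2 ^ aleph_0", so the conjunctions and
    disjunctions are those indexed by a subset of [nat -> bool]. *)
Inductive form (n : nat) : Type :=
| Eq of term n & term n
| Not of form n
| And of form n & form n
| Or of form n & form n
| Ex of form n.+1
| All of form n.+1
| BigAnd (D : set (nat -> bool)) (f : D -> form n)
| BigOr (D : set (nat -> bool)) (f : D -> form n).

Definition extend (T : Type) (n : nat) (x : T) (v : 'I_n -> T) : 'I_n.+1 -> T :=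
  fun i => if unlift ord0 i is Some j then v j else x.

Fixpoint tsubst (n m : nat) (s : 'I_n -> term m) (t : term n) : term m :=
  match t with
  | Var i => s i
  | Zero => Zero
  | Opp t => Opp (tsubst s t)
  | Add t u => Add (tsubst s t) (tsubst s u)
  end.

Definition shift (n : nat) (t : term n) : term n.+1 :=
  tsubst (fun i => Var (lift ord0 i)) t.

Definition up (n m : nat) (s : 'I_n -> term m) : 'I_n.+1 -> term m.+1 :=
  extend (Var ord0) (fun i => shift (s i)).

Fixpoint subst (n m : nat) (s : 'I_n -> term m) (p : form n) : form m :=
  match p with
  | Eq t u => Eq (tsubst s t) (tsubst s u)
  | Not p => Not (subst s p)
  | And p q => And (subst s p) (subst s q)
  | Or p q => Or (subst s p) (subst s q)
  | Ex p => Ex (subst (up s) p)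
  | All p => All (subst (up s) p)
  | BigAnd D f => BigAnd (fun i : D => subst s (f i))
  | BigOr D f => BigOr (fun i : D => subst s (f i))
  end.

Fixpoint eval (T : Type) (O : group_ops T) (n : nat) (v : 'I_n -> T)
    (t : term n) : T :=
  match t with
  | Var i => v i
  | Zero => op_zero O
  | Opp t => op_opp O (eval O v t)
  | Add t u => op_add O (eval O v t) (eval O v u)
  end.

Fixpoint sat (T : Type) (O : group_ops T) (n : nat) (v : 'I_n -> T)
    (p : form n) : Prop :=
  match p with
  | Eq t u => eval O v t = eval O v u
  | Not p => ~ sat O v p
  | And p q => sat O v p /\ sat O v q
  | Or p q => sat O v p \/ sat O v q
  | Ex p => exists x : T, sat O (extend x v) p
  | All p => forall x : T, sat O (extend x v) p
  | BigAnd D f => forall i : D, sat O v (f i)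
  | BigOr D f => exists i : D, sat O v (f i)
  end.

Definition sentence : Type := form 0.

(** The valuation is irrelevant, ['I_0] being empty. *)
Definition models (U : Type) (M : structure U) (psi : sentence) : Prop :=
  sat (ops M) (fun _ => op_zero (ops M)) psi.

Definition formula_set : Type := forall n : nat, set (form n).

Record fragment (A : formula_set) : Prop := Fragment {
  frag_atomic : forall n (t u : term n), A n (Eq t u);
  frag_not : forall n (p : form n), A n (Not p) <-> A n p;
  frag_and : forall n (p q : form n), A n (And p q) <-> A n p /\ A n q;
  frag_or : forall n (p q : form n), A n (Or p q) <-> A n p /\ A n q;
  frag_ex : forall n (p : form n.+1), A n (Ex p) <-> A n.+1 p;
  frag_all : forall n (p : form n.+1), A n (All p) <-> A n.+1 p;
  frag_bigand : forall n (D : set (nat -> bool)) (f : D -> form n),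
    A n (BigAnd f) -> forall i, A n (f i);
  frag_bigor : forall n (D : set (nat -> bool)) (f : D -> form n),
    A n (BigOr f) -> forall i, A n (f i);
  frag_subst : forall n m (s : 'I_n -> term m) (p : form n),
    A n p -> A m (subst s p)
}.

(** A type of cardinality |A|. *)
Definition formulas_of (A : formula_set) : Type := {n : nat & A n}.

Definition elementary_substructure (A : formula_set) (U : Type)
    (M N : structure U) : Prop :=
  substructure M N /\
  forall n (p : form n), A n p ->
    forall (v : 'I_n -> dom M) (w : 'I_n -> dom N),
      (forall i, val (v i) = val (w i)) -> sat (ops M) v p <-> sat (ops N) w p.

Definition struct_class : Type := forall U : Type, structure U -> Prop.
Definition struct_rel : Type := forall U : Type, structure U -> structure U -> Prop.

Definition is_union (U I : Type) (P : set I) (M : I -> structure U)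
    (N : structure U) : Prop :=
  dom N = \bigcup_(i in P) dom (M i) /\ forall i, P i -> substructure (M i) N.

Section Chains.
Variables (I : Type) (le : rel I).

Definition lt (i j : I) : Prop := le i j /\ i <> j.

Definition successor (i j : I) : Prop := lt i j /\ forall k, lt i k -> le j k.

Definition limit (i : I) : Prop :=
  (exists j, lt j i) /\ forall j, ~ successor j i.

End Chains.

(** Nonzero ordinals are represented by nonempty well-ordered types. *)
Record continuous_chain (C : struct_class) (prec : struct_rel) (U : Type)
    (I : Type) (le : rel I) (M : I -> structure U) : Prop := ContinuousChain {
  chain_wo : well_order le;
  chain_nonempty : exists i : I, True;
  chain_in : forall i, C U (M i);
  chain_succ : forall i j, successor le i j -> prec U (M i) (M j);
  chain_limit : forall i, limit le i -> is_union [set j | lt le j i] M (M i)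
}.

(** [X] represents the cardinal LS(C). *)
Definition LS_number (C : struct_class) (prec : struct_rel) (X : Type) : Prop :=
  forall (U : Type) (B : structure U) (A : set U), C U B -> A `<=` dom B ->
    exists A' : structure U,
      [/\ C U A', A `<=` dom A', prec U A' B & dom A' #<= [set: (A + X)%type]].

Record abstract_elementary_class (C : struct_class) (prec : struct_rel) : Prop :=
  AbstractElementaryClass {
  aec_rel : forall U (M N : structure U), prec U M N -> C U M /\ C U N;
  aec_iso_class : forall U V (M : structure U) (N : structure V)
    (f : dom M -> dom N), isomorphism f -> C U M -> C V N;
  aec_iso_rel : forall U V (M0 M1 : structure U) (N0 N1 : structure V)
    (f0 : dom M0 -> dom N0) (f1 : dom M1 -> dom N1),
    isomorphism f0 -> isomorphism f1 -> prec U M0 M1 ->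
    (forall x y, val x = val y -> val (f0 x) = val (f1 y)) -> prec V N0 N1;
  aec_refl : forall U (M : structure U), C U M -> prec U M M;
  aec_anti : forall U (M N : structure U), prec U M N -> prec U N M -> M = N;
  aec_trans : forall U (M N P : structure U),
    prec U M N -> prec U N P -> prec U M P;
  aec_sub : forall U (M N : structure U), prec U M N -> substructure M N;
  aec_chain : forall U I (le : rel I) (M : I -> structure U),
    continuous_chain C prec le M ->
    exists N : structure U,
      [/\ is_union [set: I] M N,
          C U N,
          forall i, prec U (M i) N &
          forall P, C U P -> (forall i, prec U (M i) P) -> prec U N P];
  aec_coherence : forall U (A B D : structure U), C U A -> C U B -> C U D ->
    prec U A D -> prec U B D -> substructure A B -> prec U A B;
  aec_LS : exists X : Type, LS_number C prec X
}.

Definition K : struct_class := cotorsionfree_group.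

Definition K_prec (A : formula_set) : struct_rel := fun U G H =>
  [/\ K G, K H & elementary_substructure A G H].

(* Main.v *)
(** Cotorsionfreeness enters only through [psi]: since [psi] belongs to the
    fragment, [K] is closed under elementary substructures and extensions.  The
    union of a continuous elementary chain is an elementary extension of its
    members by Tarski's argument, a witness in the union lying in some later
    member; infinite conjunctions cause no trouble as formulas have finitely many
    free variables.  For (A5), close the given subset under Skolem
    functions: the hull is the set of values of finite trees labelled by elements
    of the subset and formulas, and finite trees over an infinite cardinal are as
    many as the cardinal itself, because [c * c = c] for infinite [c]. *)

From mathcomp Require Import all_boot.
From mathcomp Require Import boolp classical_sets cardinality wochoice.
Require Import Defs.

Set Implicit Arguments.
Unset Strict Implicit.
Unset Printing Implicit Defensive.

Local Open Scope classical_set_scope.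
Local Open Scope card_scope.

(** * Cardinal arithmetic *)

(** By Zorn's lemma there is a maximal partial injection from [A] to [B], taken as a graph. It is
    defined on all of [A] or reaches all of [B], since otherwise one more pair could be added. *)
Lemma injection_total (T : Type) (A B : set T) :
  (exists e : T -> T, (forall x, A x -> B (e x)) /\
     forall x y, A x -> A y -> e x = e y -> x = y) \/
  (exists e : T -> T, (forall x, B x -> A (e x)) /\
     forall x y, B x -> B y -> e x = e y -> x = y).
Proof.
pose P (X : set (T * T)) := (forall x y, X (x, y) -> A x /\ B y) /\
  forall x y x' y', X (x, y) -> X (x', y') -> x = x' <-> y = y'.
have [|X [[XAB Xinj] Xmax]] := @Zorn_bigcup _ P.
  move=> F FP tot; split=> [x y [X FX Xxy]|x y x' y' [X FX Xxy] [Y FY Yxy]].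
    by have [XAB _] := FP _ FX; exact: XAB Xxy.
  have [XY|YX] := tot _ _ FX FY.
    by have [_ Yinj] := FP _ FY; exact: Yinj (XY _ Xxy) Yxy.
  by have [_ Xinj] := FP _ FX; exact: Xinj Xxy (YX _ Yxy).
have [Adom|nAdom] := pselect (forall x, A x -> exists y, X (x, y)).
  left; have /choice[e eP] : forall x, exists y, A x -> X (x, y).
    by move=> x; have [/Adom[y]|] := pselect (A x); [exists y | exists x].
  exists e; split=> [x /eP/XAB[]|x y /eP Xx /eP Xy exy] //.
  by apply/(Xinj _ _ _ _ Xx Xy).
have [Bdom|nBdom] := pselect (forall y, B y -> exists x, X (x, y)).
  right; have /choice[e eP] : forall y, exists x, B y -> X (x, y).
    by move=> y; have [/Bdom[x]|] := pselect (B y); [exists x | exists y].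
  exists e; split=> [x /eP/XAB[]|x y /eP Xx /eP Xy exy] //.
  by apply/(Xinj _ _ _ _ Xx Xy).
have [a /not_implyP[Aa na]] := (existsNP _).2 nAdom.
have [b /not_implyP[Bb nb]] := (existsNP _).2 nBdom.
case: (Xmax (X `|` [set (a, b)])).
  split=> [|sub]; first by left.
  by apply: na; exists b; apply: sub; right.
split=> [x y [/XAB|[-> ->]] //|x y x' y' [Xxy|[-> ->]] [Xxy'|[-> ->]] //].
- exact: Xinj Xxy Xxy'.
- split=> [xa|yb]; first by case: na; exists y; rewrite -xa.
  by case: nb; exists x; rewrite -yb.
- split=> [xa|yb]; first by case: na; exists y'; rewrite xa.
  by case: nb; exists x'; rewrite yb.
Qed.

Definition pairing (T : Type) (p : T -> T -> T) : Prop :=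
  forall x y x' y', p x y = p x' y' -> x = x' /\ y = y'.

Section Hessenberg.
Variables (T : Type) (h : nat -> T).
Hypothesis h_inj : injective h.

(** The underlying set is read off the diagonal, so that a partial pairing is a single set of
    triples and Zorn's lemma applies to inclusion. *)
Let field (X : set (T * T * T)) : set T := [set x | exists z, X (x, x, z)].

(* [X] is the graph of a multivalued injection of [S * S] into [S], where
   [S = field X]: single-valuedness is not needed, a value can be chosen. *)
Let partial_pairing (X : set (T * T * T)) : Prop :=
  [/\ forall x y, field X x -> field X y -> exists z, X (x, y, z),
      forall x y z, X (x, y, z) -> [/\ field X x, field X y & field X z] &
      forall x y x' y' z, X (x, y, z) -> X (x', y', z) -> x = x' /\ y = y'].

(** A countable pairing carried along [h]. A pairing that contains it has an infinite field, with
    [h 0] and [h 1] available as tags. *)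
Let G0 : set (T * T * T) :=
  [set t | exists i j, t = (h i, h j, h (pickle (i, j)))].

Let G0_partial_pairing : partial_pairing G0.
Proof.
have field_h i : field G0 (h i) by eexists; exists i, i.
split=> [_ _ [? [i [j [-> _ _]]]] [? [i' [j' [-> _ _]]]]|x y z|x y x' y' z].
- by eexists; exists i, i'.
- by case=> i [j [-> -> ->]].
- case=> i [j [-> -> ->]] [i' [j' [-> -> /h_inj]]].
  by move/(pcan_inj pickleK)=> [-> ->].
Qed.

Let maximal_partial_pairing : exists X,
  [/\ partial_pairing X, G0 `<=` X &
      forall Y, partial_pairing Y -> X `<=` Y -> Y `<=` X].
Proof.
(* Adjoining [G0] to every candidate settles the empty chain and yields a maximal pairing above
   [G0]. *)
have [|X [PX Xmax]] := @Zorn_bigcup _ (fun X => partial_pairing (G0 `|` X)).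
  move=> F FP tot; have [[X0 FX0]|F0] := pselect (exists X, F X); last first.
    suff -> : G0 `|` \bigcup_(X in F) X = G0 by [].
    by apply/seteqP; split=> [t [//|[X FX]]|t]; [case: F0; exists X|left].
  have le X t : F X -> (G0 `|` X) t -> (G0 `|` \bigcup_(X in F) X) t.
    by move=> FX [|Xt]; [left|right; exists X].
  have get t : (G0 `|` \bigcup_(X in F) X) t -> exists2 X, F X & (G0 `|` X) t.
    by case=> [|[X FX Xt]]; [exists X0; last left|exists X; last right].
  have get2 t u : (G0 `|` \bigcup_(X in F) X) t ->
      (G0 `|` \bigcup_(X in F) X) u ->
      exists X, [/\ F X, (G0 `|` X) t & (G0 `|` X) u].
    move=> /get[X FX Xt] /get[Y FY Yu].
    have [XY|YX] := tot _ _ FX FY.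
      by exists Y; split=> //; case: Xt => [|/XY]; [left|right].
    by exists X; split=> //; case: Yu => [|/YX]; [left|right].
  split=> [x y [z xz] [w yw]|x y z|x y x' y' z Xxy Xxy'].
  - have [X [FX Xx Xy]] := get2 _ _ xz yw.
    have [tot' _ _] := FP _ FX.
    have [|| u] := tot' x y; [by exists z|by exists w|].
    by move=> Xu; exists u; apply: le Xu.
  - move=> /get[X FX Xxyz]; have [_ fld _] := FP _ FX.
    by have [[u ?] [v ?] [w ?]] := fld _ _ _ Xxyz; split;
      [exists u|exists v|exists w]; apply: (le X).
  - have [X [FX Xx Xy]] := get2 _ _ Xxy Xxy'.
    by have [_ _ inj] := FP _ FX; exact: inj Xx Xy.
exists (G0 `|` X); split=> // Y PY sub; apply: contrapT => nsub.
apply: (Xmax Y); last first.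
  suff -> : G0 `|` Y = Y by [].
  by apply/setUidPr => t Gt; apply: sub; left.
by split=> [t Xt|YX]; [apply: sub; right|apply: nsub => t /YX; right].
Qed.

(** A maximal partial pairing lives on a set [S]. If the complement of [S] embeds in [S], then so
    does [T], and the pairing transfers to [T]. If [S] embeds in its complement, maximality is
    contradicted. *)
Lemma Hessenberg : exists p : T -> T -> T, pairing p.
Proof.
have [X [[Xtot Xfld Xinj] G0X Xmax]] := maximal_partial_pairing.
pose S := field X.
have Sh i : S (h i) by eexists; apply: G0X; exists i, i.
have [q qX] : exists q : T * T -> T, forall xy, S xy.1 -> S xy.2 -> X (xy, q xy).
  suff /choice[q qX] : forall xy, exists z, S xy.1 -> S xy.2 -> X (xy, z).
    by exists q.
  move=> [x y]; have [[Sx Sy]|nS] := pselect (S x /\ S y).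
    by have [z] := Xtot x y Sx Sy; exists z.
  by exists x => Sx Sy; case: nS.
have Sq x y : S x -> S y -> S (q (x, y)).
  by move=> Sx Sy; have [] := Xfld _ _ _ (qX (x, y) Sx Sy).
have q_inj x y x' y' : S x -> S y -> S x' -> S y' ->
    q (x, y) = q (x', y') -> x = x' /\ y = y'.
  move=> Sx Sy Sx' Sy' qq; apply: Xinj (qX (x, y) _ _) _ => //.
  by rewrite qq; apply: (qX (x', y')).
have h01 : h 0 <> h 1 by move/h_inj.
have [[e [eS e_inj]]|[e [eS e_inj]]] := injection_total S (~` S); last first.
  (* [c] embeds [T] in [S]: the tags separate the points of [S] from the images of the points
     outside it. *)
  pose c x := if pselect (S x) is left _ then q (h 0, x) else q (h 1, e x).
  have Sc x : S (c x).
    by rewrite /c; case: pselect => [|/eS] ?; apply: Sq.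
  have c_inj : injective c.
    move=> x y; rewrite /c; case: pselect => Sx; case: pselect => Sy.
    - by case/q_inj.
    - by case/q_inj=> //; exact: eS.
    - by case/q_inj=> // [|/esym]; first exact: eS.
    - by case/q_inj=> //; try exact: eS; move=> _; exact: e_inj.
  by exists (fun x y => q (c x, c y)) => x y x' y' /q_inj[]// /c_inj-> /c_inj->.
(* [S] embeds into its complement: the pairing extends to [S] together with a
   disjoint copy of [S], the new pairs being sent into this copy. *)
pose c w k := (S w /\ k = q (h 0, w)) \/ (exists s, [/\ S s, w = e s & k = q (h 1, s)]).
have Sc w k : c w k -> S k by case=> [[Sw ->]|[s [Ss _ ->]]]; apply: Sq.
have c_inj w w' k : c w k -> c w' k -> w = w'.
  move=> [[Sw ->]|[s [Ss -> ->]]] [[Sw' /q_inj[]//]|[s' [Ss' -> /q_inj[]//]]].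
  - by move/esym.
  - by move=> _ ->.
(* Both copies are coded in [S] by [c]. A new value [e (q (k, l))] lies outside [S], hence differs
   from every old value. *)
pose Y := X `|` [set t | exists k l, [/\ c t.1.1 k, c t.1.2 l,
   ~ (S t.1.1 /\ S t.1.2) & t.2 = e (q (k, l))]].
have YS x : S x -> field Y x by case=> z; exists z; left.
have Ye s : S s -> field Y (e s).
  move=> Ss; exists (e (q (q (h 1, s), q (h 1, s)))); right.
  exists (q (h 1, s)), (q (h 1, s)).
  by split=> //=; [right; exists s|right; exists s|case=> /(eS _ Ss)].
have Yc x k : c x k -> field Y x.
  by case=> [[/YS]|[s [/Ye ? ->]]].
have cY x : field Y x -> exists k, c x k.
  case=> z [Xz|[k [l [/= cx _ _ _]]]]; last by exists k.
  by exists (q (h 0, x)); left; split=> //; exists z.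
have YX : Y `<=` X.
  apply: Xmax => [|t]; last by left.
  split=> [x y /cY[k cx] /cY[l cy]|x y z [Xxy|[k [l [/= cx cy _ ->]]]]|].
  - have [[Sx Sy]|nS] := pselect (S x /\ S y).
      by exists (q (x, y)); left; apply: (qX (x, y)).
    by exists (e (q (k, l))); right; exists k, l.
  - by have [/YS ? /YS ? /YS] := Xfld _ _ _ Xxy.
  - by split; [exact: Yc cx|exact: Yc cy|apply: Ye; apply: Sq; apply: Sc; eassumption].
  move=> x y x' y' z [Xxy|[k [l [/= cx cy _ ->]]]].
    case=> [|[k [l [/= cx cy _ ze]]]]; first exact: Xinj.
    have [_ _] := Xfld _ _ _ Xxy; rewrite ze => Se.
    by have := eS _ (Sq _ _ (Sc _ _ cx) (Sc _ _ cy)).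
  case=> [Xxy|[k' [l' [/= cx' cy' _]]]].
    have [_ _ Se] := Xfld _ _ _ Xxy.
    by have := eS _ (Sq _ _ (Sc _ _ cx) (Sc _ _ cy)).
  move: (Sc _ _ cx) (Sc _ _ cy) (Sc _ _ cx') (Sc _ _ cy') => Sk Sl Sk' Sl'.
  move/e_inj => /(_ (Sq _ _ Sk Sl) (Sq _ _ Sk' Sl')) /q_inj[]// kk ll.
  by split; [apply: c_inj cx _; rewrite kk|apply: c_inj cy _; rewrite ll].
(* If this new triple were in [X], then [e (h 0)] would lie in [S]. *)
have : Y (h 0, e (h 0), e (q (q (h 0, h 0), q (h 1, h 0)))).
  right; exists (q (h 0, h 0)), (q (h 1, h 0)).
  by split=> //=; [left|right; exists (h 0)|case=> _ /(eS _ (Sh 0))].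
by move/YX/Xfld=> [_ Se _]; have := eS _ (Sh 0).
Qed.

End Hessenberg.

Inductive tree (T : Type) : Type :=
| Leaf of T
| Node of tree T & tree T.

(** The tags [h 0] and [h 1] tell leaves from nodes, and the pairing recovers the label or the two
    subtrees. *)
Lemma tree_injection (T : Type) (h : nat -> T) :
  injective h -> exists c : tree T -> T, injective c.
Proof.
move=> h_inj; have [p pP] := Hessenberg h_inj.
pose c := fix c (t : tree T) := match t with
  | Leaf a => p (h 0) a
  | Node t u => p (h 1) (p (c t) (c u))
  end.
exists c; elim=> [a|t IHt u IHu] [b|t' u'] /= /pP[hh].
- by move=> ->.
- by have := h_inj _ _ hh.
- by have := h_inj _ _ hh.
- by case/pP=> /IHt-> /IHu->.
Qed.

(** * Elementary maps *)

Section ElementaryMaps.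
Variables (T T' : Type) (O : group_ops T) (O' : group_ops T').

Definition ops_morphism (f : T -> T') : Prop :=
  [/\ forall x y, f (op_add O x y) = op_add O' (f x) (f y),
      forall x, f (op_opp O x) = op_opp O' (f x) &
      f (op_zero O) = op_zero O'].

(** Stating elementarity for maps between carriers treats inclusions and isomorphisms alike. *)
Definition elementary_map (F : formula_set) (f : T -> T') : Prop :=
  forall n (p : form n), F n p -> forall v, sat O v p <-> sat O' (f \o v) p.

Lemma comp_extend (f : T -> T') n x (v : 'I_n -> T) :
  f \o extend x v = extend (f x) (f \o v).
Proof. by apply/funext => i; rewrite /extend /=; case: unlift. Qed.

Lemma eval_morphism (f : T -> T') n (v : 'I_n -> T) t :
  ops_morphism f -> f (eval O v t) = eval O' (f \o v) t.
Proof.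
case=> fD fN f0; elim: t => //= [t IHt|t IHt u IHu]; first by rewrite fN IHt.
by rewrite fD IHt IHu.
Qed.

Section Fragment.
Variable F : formula_set.
Hypothesis F_fragment : fragment F.

(** The graph of each operation is defined by an atomic formula, such as [x_0 = x_1 + x_2]. *)
Lemma elementary_morphism f : elementary_map F f -> ops_morphism f.
Proof.
move=> f_el; have atom n t u := f_el n _ (frag_atomic F_fragment t u).
pose v (x y z : T) : 'I_3 -> T := fun i => nth z [:: x; y; z] i.
split=> [x y|x|].
- have /= := (atom 3 (Var (inord 0)) (Add (Var (inord 1)) (Var (inord 2)))
    (v (op_add O x y) x y)).1.
  by rewrite /v !inordK //; apply.
- have /= := (atom 3 (Var (inord 0)) (Opp (Var (inord 1)))
    (v (op_opp O x) x x)).1.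
  by rewrite /v !inordK //; apply.
- by have /= := (atom 1 (Var ord0) Zero (fun=> op_zero O)).1; apply.
Qed.

(** Only quantifiers call on the test; the infinite connectives leave the valuation unchanged and
    are handled one member at a time. *)
Lemma Tarski_Vaught f : injective f -> ops_morphism f ->
  (forall n (p : form n.+1) (v : 'I_n -> T), @F n.+1 p ->
     (exists y, sat O' (extend y (f \o v)) p) ->
     exists x, sat O' (extend (f x) (f \o v)) p) ->
  elementary_map F f.
Proof.
move=> f_inj f_morph test n p.
elim: p => {n} [n t u|n p IH|n p IHp q IHq|n p IHp q IHq|n p IH|n p IH|
                n D g IH|n D g IH] Fp v /=.
- by rewrite -!eval_morphism //; split=> [->|/f_inj].
- by have := IH ((frag_not F_fragment p).1 Fp) v => /=; tauto.
- have [Fp1 Fq] := (frag_and F_fragment p q).1 Fp.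
  by have := IHp Fp1 v; have := IHq Fq v => /=; tauto.
- have [Fp1 Fq] := (frag_or F_fragment p q).1 Fp.
  by have := IHp Fp1 v; have := IHq Fq v => /=; tauto.
- move/(frag_ex F_fragment): Fp => Fp.
  split=> [[x /(IH Fp)]|/(test _ _ _ Fp)[x]]; rewrite -?comp_extend.
    by exists (f x); rewrite -comp_extend.
  by move/(IH Fp); exists x.
- move/(frag_all F_fragment): Fp => Fp.
  split=> allp x; last by apply/(IH Fp); rewrite comp_extend.
  (* A counterexample in the target satisfies [Not p], so the test yields one in the image of
     [f]. *)
  apply: contrapT => np.
  have [|y] := test _ (Not p) v ((frag_not F_fragment p).2 Fp); first by exists x.
  by rewrite -comp_extend /= => ny; apply: ny; apply/(IH Fp).
- by split=> all_g i; apply/(IH i (frag_bigand F_fragment Fp i)).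
- by split=> -[i /(IH i (frag_bigor F_fragment Fp i))]; exists i.
Qed.

End Fragment.

(** The inverse [g] pulls witnesses back, so the induction runs over all formulas and [F] is
    arbitrary. *)
Lemma isomorphism_elementary F (f : T -> T') (g : T' -> T) :
  cancel f g -> cancel g f -> ops_morphism f -> elementary_map F f.
Proof.
move=> fK gK f_morph n p _.
elim: p => {n} [n t u|n p IH|n p IHp q IHq|n p IHp q IHq|n p IH|n p IH|
                n D h IH|n D h IH] v /=.
- by rewrite -!eval_morphism //; split=> [->|/(can_inj fK)].
- by have := IH v; tauto.
- by have := IHp v; have := IHq v; tauto.
- by have := IHp v; have := IHq v; tauto.
- split=> -[x]; first by move/IH; rewrite comp_extend; exists (f x).
  by rewrite -(gK x) -comp_extend => /IH; exists (g x).
- split=> allp x; last by apply/IH; rewrite comp_extend.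
  by rewrite -(gK x) -comp_extend; apply/IH.
- by split=> all_h i; apply/IH.
- by split=> -[i /IH]; exists i.
Qed.

End ElementaryMaps.

Lemma elementary_map_comp F (T1 T2 T3 : Type) (O1 : group_ops T1)
    (O2 : group_ops T2) (O3 : group_ops T3) (f : T1 -> T2) (g : T2 -> T3) :
  elementary_map O1 O2 F f -> elementary_map O2 O3 F g ->
  elementary_map O1 O3 F (g \o f).
Proof.
by move=> f_el g_el n p Fp v; rewrite (f_el n p Fp) (g_el n p Fp).
Qed.

(** Applied to inclusion maps, this gives coherence (A4). *)
Lemma elementary_map_cancel F (T1 T2 T3 : Type) (O1 : group_ops T1)
    (O2 : group_ops T2) (O3 : group_ops T3) (f : T1 -> T2) (g : T2 -> T3) :
  elementary_map O1 O3 F (g \o f) -> elementary_map O2 O3 F g ->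
  elementary_map O1 O2 F f.
Proof.
by move=> gf_el g_el n p Fp v; rewrite (gf_el n p Fp) (g_el n p Fp).
Qed.

Lemma elementary_map_can F (T1 T2 : Type) (O1 : group_ops T1)
    (O2 : group_ops T2) (f : T1 -> T2) (g : T2 -> T1) :
  cancel g f -> elementary_map O1 O2 F f -> elementary_map O2 O1 F g.
Proof.
move=> gK f_el n p Fp v; rewrite (f_el n p Fp).
by rewrite (_ : f \o (g \o v) = v) //; apply/funext => i /=; rewrite gK.
Qed.

(** * Elementary substructures *)

Section ElementarySubstructures.
Variable F : formula_set.
Hypothesis F_fragment : fragment F.

Lemma inclusion_map (U : Type) (S S' : set U) :
  S `<=` S' -> exists f : S -> S', forall x, val (f x) = val x.
Proof.
move=> SS'; exists (fun x => exist _ (val x) (mem_set (SS' _ (set_mem (valP x))))).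
by [].
Qed.

(** Two valuations that agree under [val] differ by the inclusion map. The substructure clauses are
    recovered from the atomic formulas of [F]. *)
Lemma elementary_substructureP (U : Type) (M N : structure U) :
  elementary_substructure F M N <->
  exists f : dom M -> dom N,
    (forall x, val (f x) = val x) /\ elementary_map (ops M) (ops N) F f.
Proof.
split=> [[[MN _ _ _] MN_el]|[f [fE f_el]]].
  have [f fE] := inclusion_map MN.
  by exists f; split=> // n p Fp v; apply: MN_el => // i; rewrite fE.
have f_eq x y : val x = val y -> f x = y.
  by move=> xy; apply: val_inj; rewrite fE.
have [fD fN f0] := elementary_morphism F_fragment f_el.
split=> [|n p Fp v w vw]; last first.
  by rewrite f_el // (_ : f \o v = w) //; apply/funext => i; exact: f_eq.
split=> [u Mu|x y x' y' /f_eq<- /f_eq<-|x x' /f_eq<-|].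
- by have := valP (f (exist _ u (mem_set Mu))); rewrite fE => /set_mem.
- by rewrite -fD fE.
- by rewrite -fN fE.
- by rewrite -f0 fE.
Qed.

Lemma elementary_substructure_refl (U : Type) (M : structure U) :
  elementary_substructure F M M.
Proof. by apply/elementary_substructureP; exists id; split. Qed.

Lemma elementary_substructure_trans (U : Type) (M N P : structure U) :
  elementary_substructure F M N -> elementary_substructure F N P ->
  elementary_substructure F M P.
Proof.
move=> /elementary_substructureP[f [fE f_el]].
move=> /elementary_substructureP[g [gE g_el]].
apply/elementary_substructureP; exists (g \o f).
by split=> [x|]; [rewrite /= gE | exact: elementary_map_comp f_el g_el].
Qed.

Lemma elementary_substructure_coherence (U : Type) (M N P : structure U) :
  dom M `<=` dom N -> elementary_substructure F M P ->
  elementary_substructure F N P -> elementary_substructure F M N.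
Proof.
move=> /inclusion_map[h hE] /elementary_substructureP[f [fE f_el]].
move=> /elementary_substructureP[g [gE g_el]].
apply/elementary_substructureP; exists h; split=> //.
apply: elementary_map_cancel g_el.
suff -> : g \o h = f by [].
by apply/funext => x; apply: val_inj; rewrite /= gE hE fE.
Qed.

Lemma elementary_substructure_isomorphism (U V : Type) (M0 M1 : structure U)
    (N0 N1 : structure V) (f0 : dom M0 -> dom N0) (f1 : dom M1 -> dom N1) :
  isomorphism f0 -> isomorphism f1 ->
  (forall x y, val x = val y -> val (f0 x) = val (f1 y)) ->
  elementary_substructure F M0 M1 -> elementary_substructure F N0 N1.
Proof.
move=> [[g0 f0K g0K] f0D f0N f00] [[g1 f1K g1K] f1D f1N f10] f01.
move=> /elementary_substructureP[f [fE f_el]].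
apply/elementary_substructureP; exists (f1 \o f \o g0); split=> [x|] /=.
  by rewrite -[in RHS](g0K x); apply/esym/f01; rewrite fE.
have f0_el : elementary_map (ops M0) (ops N0) F f0.
  exact: isomorphism_elementary f0K g0K _.
have f1_el : elementary_map (ops M1) (ops N1) F f1.
  exact: isomorphism_elementary f1K g1K _.
apply: elementary_map_comp (elementary_map_can g0K f0_el) _.
exact: elementary_map_comp f_el f1_el.
Qed.

Lemma elementary_substructure_models (U : Type) (M N : structure U) (p : sentence) :
  elementary_substructure F M N -> @F 0 p -> models M p <-> models N p.
Proof. by move=> [_ MN_el] Fp; apply: MN_el => // -[]. Qed.

Lemma isomorphism_models (U V : Type) (M : structure U) (N : structure V)
    (f : dom M -> dom N) (p : sentence) :
  isomorphism f -> models M p <-> models N p.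
Proof.
move=> [[g fK gK] fD fN f0]; rewrite /models.
have f_el : elementary_map (ops M) (ops N) (fun _ => setT) f.
  exact: isomorphism_elementary fK gK _.
rewrite (f_el 0 p I) (_ : f \o _ = fun=> op_zero (ops N)) //.
by apply/funext => -[].
Qed.

Lemma substructure_anti (U : Type) (M N : structure U) :
  substructure M N -> substructure N M -> M = N.
Proof.
case: M N => [S [aM oM zM]] [S' [aN oN zN]] [/= SS' D N0 Z] [/= S'S _ _ _].
have SE : S = S' by apply/seteqP.
(* Identifying the two domains gives the operations the same type, so that they can be compared
   pointwise. *)
case: S' / SE => /= in SS' S'S aN oN zN D N0 Z *.
congr (Structure (GroupOps _ _ _)).
- by apply/funext => x; apply/funext => y; apply/val_inj/D.
- by apply/funext => x; apply/val_inj/N0.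
- exact: val_inj.
Qed.

(** The test already makes [S] closed under the operations: applied to [x_0 = t], where shifting
    keeps [x_0] out of [t], it puts the value of [t] into [S]. *)
Lemma Tarski_Vaught_substructure (U : Type) (N : structure U) (S : set (dom N)) :
  (forall n (p : form n.+1) (v : 'I_n -> dom N), @F n.+1 p ->
     (forall i, S (v i)) -> (exists y, sat (ops N) (extend y v) p) ->
     exists x, S x /\ sat (ops N) (extend x v) p) ->
  exists M : structure U,
    dom M = [set val x | x in S] /\ elementary_substructure F M N.
Proof.
move=> test; pose D := [set val x | x in S].
have [f fE] : exists f : D -> dom N, forall x, val (f x) = val x.
  apply: inclusion_map => _ [x Sx <-]; exact: set_mem (valP x).
have f_inj : injective f by move=> x y /(congr1 val); rewrite !fE => /val_inj.
have Sf x : S (f x).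
  have [y Sy yx] := set_mem (valP x).
  by rewrite (_ : f x = y) //; apply: val_inj; rewrite fE.
have f_surj x : S x -> exists y, f y = x.
  move=> Sx; have Dx : D (val x) by exists x.
  by exists (exist (fun u => u \in D) (val x) (mem_set Dx)); apply: val_inj; rewrite fE.
have closed n (t : term n) v : (forall i, S (v i)) ->
    exists y, f y = eval (ops N) v t.
  move=> Sv; have Ft := frag_atomic F_fragment (Var ord0) (shift t).
  have shiftE x : eval (ops N) (extend x v) (shift t) = eval (ops N) v t.
    rewrite /shift; elim: t {Ft} => //= [i|t ->|t -> u ->] //.
    by rewrite /extend liftK.
  have x0E x : extend x v ord0 = x by rewrite /extend unlift_none.
  have [|x [/f_surj[y <-]]] := test _ _ v Ft Sv.
    by exists (eval (ops N) v t); rewrite /= x0E shiftE.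
  by rewrite /= x0E shiftE; exists y.
have /choice[add addE] : forall xy : D * D, exists z,
    f z = op_add (ops N) (f xy.1) (f xy.2).
  move=> [x y]; pose v (i : 'I_2) := f (nth y [:: x; y] i).
  have [i|z] := closed 2 (Add (Var ord0) (Var ord_max)) v; first exact: Sf.
  by exists z.
have /choice[opp oppE] : forall x, exists z, f z = op_opp (ops N) (f x).
  by move=> x; apply: (closed 1 (Opp (Var ord0)) (fun=> f x)).
have [zero zeroE] : exists z, f z = op_zero (ops N).
  by apply: (closed 0 Zero (fun=> op_zero (ops N))) => -[].
exists (Structure (GroupOps (fun x y => add (x, y)) opp zero)); split=> //.
apply/elementary_substructureP; exists f; split=> //=.
apply: Tarski_Vaught => // [|n p v Fp ex].
  by split=> [x y|x|] /=; rewrite ?addE ?oppE ?zeroE.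
have [|_ [/f_surj[y <-] py]] := test n p (f \o v) Fp _ ex; last by exists y.
by move=> i; exact: Sf.
Qed.

End ElementarySubstructures.

(** * Directed unions *)

Section DirectedUnions.
Variables (F : formula_set) (U I : Type) (P : set I) (M : I -> structure U).
Hypothesis F_fragment : fragment F.
Hypothesis P_nonempty : exists i, P i.
Hypothesis M_directed : forall i j, P i -> P j -> exists k,
  [/\ P k, elementary_substructure F (M i) (M k) &
      elementary_substructure F (M j) (M k)].

(** A sum is computed in any member containing both arguments. The result does not depend on the
    member, because any two members lie in a third. *)
Lemma directed_union_exists : exists N, is_union P M N.
Proof.
pose D := \bigcup_(i in P) dom (M i).
have MD i : P i -> dom (M i) `<=` D by move=> Pi u Mu; exists i.
have D_mem (x : D) : exists2 i, P i & exists x' : dom (M i), val x' = val x.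
  have [i Pi Mx] := set_mem (valP x).
  by exists i => //; exists (exist (fun u => u \in dom (M i)) (val x) (mem_set Mx)).
have val_mem i (x : dom (M i)) : P i -> exists z : D, val z = val x.
  by move=> Pi; have [f fE] := inclusion_map (MD i Pi); exists (f x).
have sub_lift i k (x : dom (M i)) : substructure (M i) (M k) ->
    exists y : dom (M k), val y = val x.
  by move=> [/inclusion_map[f fE] _ _ _]; exists (f x).
have [add addE] : exists add : D * D -> D, forall xy i (x y : dom (M i)),
    P i -> val x = val xy.1 -> val y = val xy.2 ->
    val (op_add (ops (M i)) x y) = val (add xy).
  suff /choice[add addE] : forall xy : D * D, exists z : D,
      forall i (x y : dom (M i)), P i -> val x = val xy.1 -> val y = val xy.2 ->
      val (op_add (ops (M i)) x y) = val z by exists add.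
  move=> [x y]; have [i Pi [x1 x1E]] := D_mem x; have [j Pj [y1 y1E]] := D_mem y.
  have [k [Pk [ik _] [jk _]]] := M_directed Pi Pj.
  have [x2 x2E] := sub_lift _ _ x1 ik; have [y2 y2E] := sub_lift _ _ y1 jk.
  have [z zE] := val_mem k (op_add (ops (M k)) x2 y2) Pk.
  exists z => l x3 y3 Pl x3E y3E; have [m [_ [km _] [lm _]]] := M_directed Pk Pl.
  have [x4 x4E] := sub_lift _ _ x3 lm; have [y4 y4E] := sub_lift _ _ y3 lm.
  have [_ kmD _ _] := km; have [_ lmD _ _] := lm.
  rewrite zE (lmD _ _ x4 y4) // (kmD _ _ x4 y4) //.
    by rewrite x4E x3E x2E x1E.
  by rewrite y4E y3E y2E y1E.
have [opp oppE] : exists opp : D -> D, forall x i (x' : dom (M i)),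
    P i -> val x' = val x -> val (op_opp (ops (M i)) x') = val (opp x).
  suff /choice[opp oppE] : forall x : D, exists z : D,
      forall i (x' : dom (M i)), P i -> val x' = val x ->
      val (op_opp (ops (M i)) x') = val z by exists opp.
  move=> x; have [i Pi [x1 x1E]] := D_mem x.
  have [z zE] := val_mem i (op_opp (ops (M i)) x1) Pi.
  exists z => l x3 Pl x3E; have [m [_ [im _] [lm _]]] := M_directed Pi Pl.
  have [x4 x4E] := sub_lift _ _ x3 lm.
  have [_ _ imN _] := im; have [_ _ lmN _] := lm.
  by rewrite zE (lmN _ x4) // (imN _ x4) // x4E x3E x1E.
have [zero zeroE] : exists zero : D, forall i, P i ->
    val (op_zero (ops (M i))) = val zero.
  have [i Pi] := P_nonempty; have [z zE] := val_mem i (op_zero (ops (M i))) Pi.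
  exists z => j Pj; have [m [_ [[_ _ _ im] _] [[_ _ _ jm] _]]] := M_directed Pi Pj.
  by rewrite zE im jm.
exists (Structure (GroupOps (fun x y => add (x, y)) opp zero)); split=> // i Pi.
split=> [|x y x' y' xx' yy'|x x' xx'|] /=; first exact: MD.
- exact: addE.
- exact: oppE.
- exact: zeroE.
Qed.

Variable N : structure U.
Hypothesis N_union : is_union P M N.

Let union_mem (x : dom N) : exists2 i, P i & dom (M i) (val x).
Proof. by have := set_mem (valP x); move: (val x) => u; rewrite N_union.1. Qed.

(** Directedness is used once per variable, and there are finitely many. *)
Lemma directed_union_valuation n (v : 'I_n -> dom N) :
  exists2 i, P i & exists v' : 'I_n -> dom (M i), forall k, val (v' k) = val (v k).
Proof.
suff [i Pi /choice[v' v'E]] : exists2 i, P i &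
    forall k, exists x : dom (M i), val x = val (v k).
  by exists i => //; exists v'.
elim: n v => [|n IHn] v; first by have [i Pi] := P_nonempty; exists i => // -[].
have [i Pi iv] := IHn (fun k => v (lift ord0 k)).
have [j Pj Mv] := union_mem (v ord0).
have [k [Pk [[ik _ _ _] _] [[jk _ _ _] _]]] := M_directed Pi Pj.
have [f fE] := inclusion_map ik.
exists k => // l; case: (unliftP ord0 l) => [l' ->|->].
  by have [x xE] := iv l'; exists (f x); rewrite fE.
by exists (exist (fun u => u \in dom (M k)) _ (mem_set (jk _ Mv))).
Qed.

(** The induction on [p] treats all members at once, since a witness may live in a larger member
    [M k]. There it verifies the quantified formula as a whole, and this formula is what passes back
    from [M k] to [M j]. *)
Lemma directed_union_elementary i : P i -> elementary_substructure F (M i) N.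
Proof.
move=> Pi; split=> [|n p]; first exact: N_union.2.
(* The inclusion into [N] is available for indices in [P], hence the proof argument of [g]. *)
have [g gE] : exists g : forall j, P j -> dom (M j) -> dom N,
    forall j (Pj : P j) x, val (g j Pj x) = val x.
  suff gE j : exists g : P j -> dom (M j) -> dom N,
      forall Pj x, val (g Pj x) = val x.
    by exists (fun j => sval (cid (gE j))) => j; exact: (svalP (cid (gE j))).
  have [Pj|nPj] := pselect (P j); last by exists (fun Pj => False_rect _ (nPj Pj)).
  have [jN _ _ _] := N_union.2 j Pj; have [f fE] := inclusion_map jN.
  by exists (fun=> f).
suff g_el : @F n p -> forall i (Pi : P i) (v : 'I_n -> dom (M i)),
    sat (ops (M i)) v p <-> sat (ops N) (g i Pi \o v) p.
  move=> Fp v w vw; rewrite (g_el Fp i Pi) (_ : g i Pi \o v = w) //.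
  by apply/funext => k; apply: val_inj; rewrite /= gE vw.
have g_morph j (Pj : P j) : ops_morphism (ops (M j)) (ops N) (g j Pj).
  have [_ D N0 Z] := N_union.2 j Pj.
  split=> [x y|x|]; apply: val_inj; rewrite gE; last exact: Z.
    by apply: D; rewrite gE.
  by apply: N0; rewrite gE.
have g_inj j (Pj : P j) : injective (g j Pj).
  by move=> x y /(congr1 val); rewrite !gE => /val_inj.
(* A witness of a quantifier over [N] lies in some [M k] extending [M j]. *)
have step j (Pj : P j) m (v : 'I_m -> dom (M j)) (x : dom N) :
    exists k (Pk : P k) (h : dom (M j) -> dom (M k)) (y : dom (M k)),
    [/\ elementary_map (ops (M j)) (ops (M k)) F h, g k Pk y = x &
        g k Pk \o (h \o v) = g j Pj \o v].
  have [l Pl Mx] := union_mem x.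
  have [k [Pk /(elementary_substructureP F_fragment)[h [hE h_el]] lk]] :=
    M_directed Pj Pl.
  have [[lk_dom _ _ _] _] := lk.
  exists k, Pk, h, (exist (fun u => u \in dom (M k)) _ (mem_set (lk_dom _ Mx))).
  split=> //; first by apply: val_inj; rewrite gE.
  by apply/funext => a; apply: val_inj; rewrite /= !gE hE.
elim: p {i Pi} => {n} [n t u|n p IH|n p IHp q IHq|n p IHp q IHq|n p IH|n p IH|
                n D f IH|n D f IH] Fp j Pj v /=.
- by rewrite -!(eval_morphism _ _ (g_morph j Pj)); split=> [->|/g_inj].
- by have := IH ((frag_not F_fragment p).1 Fp) j Pj v => /=; tauto.
- have [Fp1 Fq] := (frag_and F_fragment p q).1 Fp.
  by have := IHp Fp1 j Pj v; have := IHq Fq j Pj v => /=; tauto.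
- have [Fp1 Fq] := (frag_or F_fragment p q).1 Fp.
  by have := IHp Fp1 j Pj v; have := IHq Fq j Pj v => /=; tauto.
- have Fp1 := (frag_ex F_fragment p).1 Fp.
  split=> [[x /(IH Fp1 j Pj)]|[x]].
    by rewrite comp_extend; exists (g j Pj x).
  have [k [Pk [h [y [h_el <- <-]]]]] := step j Pj n v x.
  by rewrite -comp_extend => /(IH Fp1) py; apply/(h_el _ _ Fp v); exists y.
- have Fp1 := (frag_all F_fragment p).1 Fp.
  split=> [allp x|allp x]; last by apply/(IH Fp1 j Pj); rewrite comp_extend.
  have [k [Pk [h [y [h_el <- <-]]]]] := step j Pj n v x.
  by rewrite -comp_extend; apply/(IH Fp1); apply: ((h_el _ _ Fp v).1 allp).
- by split=> all_f i; apply/(IH i (frag_bigand F_fragment Fp i) j Pj).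
- by split=> -[i /(IH i (frag_bigor F_fragment Fp i) j Pj)]; exists i.
Qed.

(** The parameters of a formula lie in a single member [M i], through which [N] and [Q] are
    compared. *)
Lemma directed_union_least (Q : structure U) :
  (forall i, P i -> elementary_substructure F (M i) Q) ->
  elementary_substructure F N Q.
Proof.
move=> MQ; have [|f fE] := @inclusion_map _ (dom N) (dom Q).
  by rewrite N_union.1 => u [i Pi]; have [[iQ _ _ _] _] := MQ i Pi; exact: iQ.
apply/(elementary_substructureP F_fragment); exists f; split=> // n p Fp v.
have [i Pi [v' v'E]] := directed_union_valuation v.
have [_ iN] := directed_union_elementary Pi; have [_ iQ] := MQ i Pi.
rewrite -(iN n p Fp v') //; apply: iQ => // k.
exact: etrans (v'E k) (esym (fE _)).
Qed.

End DirectedUnions.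

(** * Continuous chains *)

Section WellOrders.
Variables (I : Type) (le : rel I).
Hypothesis le_wo : well_order le.

Lemma well_order_min (P : I -> Prop) :
  (exists i, P i) -> exists2 i, P i & forall j, P j -> le i j.
Proof.
move=> [i Pi]; have [|m [[]]] := le_wo (A := fun i => `[< P i >]).
  by exists i; exact/asboolP.
move=> /asboolP Pm m_min _; exists m => // j Pj.
by apply: m_min; exact/asboolP.
Qed.

(** The order laws come from the minimum of the set of [i] and [j]: its existence gives totality,
    its uniqueness antisymmetry. *)
Lemma well_order_total i j : le i j \/ le j i.
Proof.
have [|m [->|->] m_min] := @well_order_min (fun k => k = i \/ k = j).
- by exists i; left.
- by left; apply: m_min; right.
- by right; apply: m_min; left.
Qed.

Lemma well_order_refl i : le i i.
Proof. by have [] := well_order_total i i. Qed.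

Lemma well_order_anti i j : le i j -> le j i -> i = j.
Proof.
move=> ij ji; have [|m [_ m_uniq]] := le_wo (A := fun k => `[< k = i \/ k = j >]).
  by exists i; apply/asboolP; left.
have min_of k : k = i \/ k = j -> minimum_of le (fun k => `[< k = i \/ k = j >]) k.
  move=> kij; split=> [|l /asboolP]; first exact/asboolP.
  by case: kij => -> [] -> //; exact: well_order_refl.
by rewrite -(m_uniq i) ?(m_uniq j) //; apply: min_of; [right|left].
Qed.

Lemma well_order_ind (P : I -> Prop) :
  (forall i, (forall j, lt le j i -> P j) -> P i) -> forall i, P i.
Proof.
move=> step i; apply: contrapT => nPi.
have [|m nPm m_min] := @well_order_min (fun k => ~ P k); first by exists i.
apply: nPm; apply: step => j [jm nj]; apply: contrapT => nPj.
by apply: nj; apply: well_order_anti => //; exact: m_min.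
Qed.

End WellOrders.

(** A chain is given by its successor steps and its unions at limits; comparison of arbitrary
    members follows by transfinite induction on the larger index. *)
Lemma chain_elementary (F : formula_set) (C : struct_class) (prec : struct_rel)
    (U I : Type) (le : rel I) (M : I -> structure U) :
  fragment F ->
  (forall M N : structure U, prec U M N -> elementary_substructure F M N) ->
  continuous_chain C prec le M ->
  forall i j, le i j -> elementary_substructure F (M i) (M j).
Proof.
move=> F_fragment prec_el [le_wo _ _ M_succ M_lim] i j; move: i.
elim/(well_order_ind le_wo): j => j IH i ij.
have [->|nij] := pselect (i = j); first exact: elementary_substructure_refl.
have [[k kj]|no_pred] := pselect (exists k, successor le k j).
  have [kj_lt j_min] := kj.
  apply: (elementary_substructure_trans F_fragment) (prec_el _ _ (M_succ _ _ kj)).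
  (* If [k] were strictly below [i], the successor [j] of [k] would satisfy [le j i], forcing
     [i = j]. *)
  apply: IH => //; have [//|ki] := well_order_total le_wo i k.
  have [ik|nki] := pselect (k = i); first by rewrite ik well_order_refl.
  by case: nij; apply: (well_order_anti le_wo) => //; exact: j_min.
(* Here [j] is a limit, and the induction hypothesis makes the earlier members a directed family
   with union [M j]. *)
apply: (directed_union_elementary F_fragment _ (P := [set k | lt le k j])) => //; last first.
  apply: M_lim; split; first by exists i.
  by move=> k kj; apply: no_pred; exists k.
move=> a b aj bj; have [ab|ba] := well_order_total le_wo a b.
  by exists b; split=> //; apply: IH => //; exact: well_order_refl.
by exists a; split=> //; apply: IH => //; exact: well_order_refl.
Qed.

(** * Skolem hulls *)

Lemma extend_nth (T : Type) (x0 : T) (s : seq T) n y :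
  extend y (fun i : 'I_n => nth x0 s i) = fun i : 'I_n.+1 => nth x0 (y :: s) i.
Proof.
apply/funext => i; case: (unliftP ord0 i) => [j|] ->.
  by rewrite /extend liftK lift0.
by rewrite /extend unlift_none.
Qed.

Definition to_form (F : formula_set) (q : formulas_of F) : form (projT1 q) :=
  val (projT2 q).

(** Arguments are lists read with default [x0], so that the Skolem functions of formulas of all
    arities share one type. *)
Lemma Skolem_function (F : formula_set) (T : Type) (O : group_ops T) x0 :
  exists sk : formulas_of F -> seq T -> T, forall q s,
    (exists y, sat O (fun i => nth x0 (y :: s) i) (to_form q)) ->
    sat O (fun i => nth x0 (sk q s :: s) i) (to_form q).
Proof.
pose P (qs : formulas_of F * seq T) z :=
  sat O (fun i => nth x0 (z :: qs.2) i) (to_form qs.1).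
have /choice[sk skP] : forall qs, exists z, (exists y, P qs y) -> P qs z.
  move=> qs; have [[y Py]|nP] := pselect (exists y, P qs y); first by exists y.
  by exists x0.
by exists (fun q s => sk (q, s)) => q s; apply: (skP (q, s)).
Qed.

Lemma fragment_LS_number (F : formula_set) (U : Type) (N : structure U)
    (S : set U) :
  fragment F -> S `<=` dom N ->
  exists M : structure U,
    [/\ S `<=` dom M, elementary_substructure F M N &
        dom M #<= [set: (S + formulas_of F)%type]].
Proof.
move=> F_fragment /inclusion_map[inc incE].
pose x0 := op_zero (ops N); pose V : Type := (S + formulas_of F)%type.
have [sk skP] := Skolem_function F (ops N) x0.
(* The formula [0 = 0], taken with each number [n] of free variables, shows that [V] is infinite. *)
pose h n : V := inr (existT _ n (exist (fun p => p \in @F n) (Eq Zero Zero)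
  (mem_set (frag_atomic F_fragment Zero Zero)))).
have h_inj : injective h by move=> m n [].
(* A tree denotes a list of elements of [N]; the Skolem function of a formula
   [q] applied to the list denoted by [u] is coded by [Node (Leaf (inr q)) u]. *)
pose ev := fix ev (t : tree V) : seq (dom N) := match t with
  | Leaf (inl a) => [:: inc a]
  | Leaf (inr _) => [::]
  | Node (Leaf (inr q)) u => [:: sk q (ev u)]
  | Node t u => ev t ++ ev u
  end.
pose H : set (dom N) := [set b | exists t, ev t = [:: b]].
(* A tree denoting one element thus acts as a cons, since a leaf labelled by a formula denotes the
   empty list. *)
have ev_node t u b : ev t = [:: b] -> ev (Node t u) = b :: ev u.
  case: t => [[a [<-]|q]|t1 t2 tE] //.
  by rewrite -[LHS]/(ev (Node t1 t2) ++ ev u) tE.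
have ev_list n (v : nat -> dom N) : (forall i, i < n -> H (v i)) ->
    exists t, ev t = mkseq v n.
  elim: n v => [|n IHn] v Hv; first by exists (Leaf (h 0)).
  have [|t tE] := IHn (v \o succn); first by move=> i lt_in; apply: Hv.
  have [t0 t0E] := Hv 0 isT.
  exists (Node t0 t).
  by rewrite (ev_node _ _ _ t0E) tE /mkseq /= (iotaDl 1 0) -map_comp.
have [|M [domM MN]] := @Tarski_Vaught_substructure _ F_fragment _ N H.
  move=> n p v Fp Hv ex.
  have [t tE] : exists t, forall i, v i = nth x0 (ev t) i.
    (* The valuation is extended to all of [nat], with [x0] from index [n] on. *)
    have [|t tE] := ev_list n (fun i => oapp v x0 (insub i)).
      by move=> i lt_in; rewrite insubT; exact: Hv.
    by exists t => i; rewrite tE nth_mkseq ?valK.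
  pose q : formulas_of F := existT _ n.+1 (exist (fun p => p \in @F n.+1) p (mem_set Fp)).
  have vE : v = fun i => nth x0 (ev t) i by exact/funext.
  exists (sk q (ev t)); split; first by exists (Node (Leaf (inr q)) t).
  move: ex; rewrite vE; under eq_exists do rewrite extend_nth; rewrite extend_nth.
  exact: (skP q (ev t)).
exists M; split=> //.
  rewrite domM => u Su; pose a : S := exist (fun u => u \in S) u (mem_set Su).
  by exists (inc a); [exists (Leaf (inl a))|rewrite incE].
have [c c_inj] := tree_injection h_inj.
apply: (@card_le_trans _ _ _ [set: tree V]).
  (* Each point of [M] is the head of the list of some tree; [x0] is the head for trees denoting the
     empty list. *)
  apply: (card_le_trans (B := (fun t => val (head x0 (ev t))) @` setT)).
    apply: subset_card_le; rewrite domM => _ [b [t tE] <-].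
    by exists t => //; rewrite tE.
  exact: card_image_le.
have := inj_card_eq (A := setT) (in2W c_inj).
by rewrite card_eq_le => /andP[_] /card_le_trans; apply; exact: card_leT.
Qed.

(** * Verification of the axioms of abstract elementary classes *)

Theorem theorem2p1 (psi : sentence) (A : formula_set)
  (K_eq_Mod : forall (U : Type) (M : structure U), K M <-> models M psi)
  (fragment_A : fragment A)
  (psi_in_A : A 0 psi) :
  abstract_elementary_class K (K_prec A) /\
  LS_number K (K_prec A) (formulas_of A).
Proof.
(* Since [psi] is in [A], membership in [K] transfers both ways: downwards for the Skolem hull,
   upwards for the union of a chain. *)
have K_el (U : Type) (M N : structure U) :
    elementary_substructure A M N -> K M <-> K N.
  by move=> MN; rewrite !K_eq_Mod; exact: elementary_substructure_models MN _.
have K_iso (U V : Type) (M : structure U) (N : structure V)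
    (f : dom M -> dom N) : isomorphism f -> K M -> K N.
  by move=> f_iso; rewrite !K_eq_Mod (isomorphism_models psi f_iso).
have LS : LS_number K (K_prec A) (formulas_of A).
  move=> U B S KB SB.
  have [M [SM MB cardM]] := fragment_LS_number fragment_A SB.
  have KM : K M by apply/(K_el _ _ _ MB).
  by exists M.
split=> //; split.
- by move=> U M N [].
- exact: K_iso.
- move=> U V M0 M1 N0 N1 f0 f1 f0_iso f1_iso [KM0 KM1 M01] f01; split.
  + exact: K_iso f0_iso KM0.
  + exact: K_iso f1_iso KM1.
  + exact: (elementary_substructure_isomorphism fragment_A f0_iso f1_iso).
- by move=> U M KM; split=> //; exact: elementary_substructure_refl.
- by move=> U M N [_ _ [MN _]] [_ _ [NM _]]; exact: substructure_anti.
- move=> U M N P [KM _ MN] [_ KP NP]; split=> //.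
  exact: elementary_substructure_trans MN NP.
- by move=> U M N [_ _ []].
- move=> U I le M chain_M; have [le_wo [i0 _] KM _ _] := chain_M.
  have M_el : forall i j, le i j -> elementary_substructure A (M i) (M j).
    by apply: chain_elementary chain_M => // M0 N0 [].
  have M_directed i j : [set: I] i -> [set: I] j -> exists k,
      [/\ [set: I] k, elementary_substructure A (M i) (M k) &
          elementary_substructure A (M j) (M k)].
    move=> _ _; have [ij|ji] := well_order_total le_wo i j.
      by exists j; split=> //; apply: M_el => //; exact: well_order_refl.
    by exists i; split=> //; apply: M_el => //; exact: well_order_refl.
  have I_nonempty : exists i, [set: I] i by exists i0.
  have [N N_union] := directed_union_exists I_nonempty M_directed.
  have MN i : elementary_substructure A (M i) N.
    exact: (directed_union_elementary fragment_A M_directed N_union).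
  (* Nonemptiness of the chain provides the member [M i0] whose truth of [psi] passes up to [N]. *)
  have KN : K N by apply/(K_el _ _ _ (MN i0)).
  exists N; split=> // P KP MP; split=> //.
  apply: (directed_union_least fragment_A I_nonempty M_directed N_union) => i _.
  by have [] := MP i.
- move=> U M N P KM KN _ [_ _ MP] [_ _ NP] [MN _ _ _]; split=> //.
  exact: elementary_substructure_coherence MN MP NP.
- by exists (formulas_of A).
Qed.
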